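(* Let $K$ be a compact Hausdorff space and let $\mathcal{H}$ be a finite-dimensional real Hilbert space with odd dimension. Then the real Banach space $C(K,\mathcal{H})$ satisfies the Mazur--Ulam property.
   Context: $C(K,\mathcal{H})$ is the Banach space of all continuous functions from $K$ to $\mathcal{H}$, with the supremum norm. For a Banach space $X$, $S(X)$ denotes its unit sphere. A Banach space $X$ satisfies the Mazur--Ulam property if for every (real) Banach space $Y$, every surjective isometry $\Delta:S(X)\to S(Y)$ (a map preserving the distances induced by the norms) admits an extension to a surjective real linear isometry from $X$ onto $Y$. *)

(* Defs.v *)
From HB Require Import structures.
From mathcomp Require Import all_boot all_order all_algebra.
From mathcomp Require Import all_classical all_reals all_analysis.

Set Implicit Arguments.
Unset Strict Implicit.
Unset Printing Implicit Defensive.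

Import Order.TTheory GRing.Theory Num.Theory.
Import numFieldNormedType.Exports.

Local Open Scope classical_set_scope.
Local Open Scope ring_scope.

HB.mixin Record isHilbert (R : realType) H & CompleteNormedModule R H := {
  inner : {dot H for @idfun R} ;
  norm_inner : forall x : H, `|x| = Num.sqrt (inner x x)
}.

#[short(type="hilbertType")]
HB.structure Definition Hilbert (R : realType) :=
  {H of isHilbert R H & CompleteNormedModule R H}.

#[short(type="finDimHilbertType")]
HB.structure Definition FinDimHilbert (R : realType) :=
  {H of Hilbert R H & Vector R H}.

(* The compactness proof is a parameter of the type so that the supremum norm,
   finite because K is compact, can be a canonical structure. When K is empty
   the supremum is [sup set0 = 0] and the space is trivial. *)
Definition contfun (R : realType) (K : topologicalType)
  (cptK : compact [set: K]) (V : normedModType R) : Type := continuousType K V.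

Section contfun_lmodule.
Context (R : realType) (K : topologicalType) (cptK : compact [set: K]).
Context (V : normedModType R).
Local Notation C := (contfun cptK V).

HB.instance Definition _ := Choice.on C.

Definition contfun_fun (f : C) : K -> V := @Continuous.sort K V f.
Coercion contfun_fun : C >-> Funclass.

Definition contfun_pred : {pred K -> V} := mem [set f : K -> V | continuous f].

Lemma contfun_cts (f : C) : continuous f.
Proof. exact: (@cts_fun K V f). Qed.

Definition contfun_Sub (f : K -> V) (Pf : f \in contfun_pred) : C :=
  [the continuousType K V of mkcts (set_mem Pf)].

Let contfun_rect (P : C -> Type) :
  (forall f (Pf : f \in contfun_pred), P (contfun_Sub Pf)) ->
  forall u : C, P u.
Proof.
move=> PSub u.
have Pu : contfun_fun u \in contfun_pred.
  by apply: mem_set; exact: contfun_cts.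
suff -> : u = contfun_Sub Pu by exact: PSub.
exact/(@continuousEP K V u (contfun_Sub Pu)).
Qed.

Let contfun_SubK f (Pf : f \in contfun_pred) :
  contfun_fun (contfun_Sub Pf) = f.
Proof. by []. Qed.

HB.instance Definition _ := isSub.Build (K -> V) contfun_pred C
  contfun_rect contfun_SubK.

Lemma contfun_submod_closed : submod_closed contfun_pred.
Proof.
split; first by apply: mem_set => x; exact: cvg_cst.
move=> a f g /set_mem cf /set_mem cg; apply: mem_set => x.
by apply: cvgD; [apply: cvgZl_tmp; exact: cf|exact: cg].
Qed.

HB.instance Definition _ := GRing.isSubmodClosed.Build R (K -> V) contfun_pred
  contfun_submod_closed.
HB.instance Definition _ := [SubChoice_isSubLmodule of C by <:].

Lemma contfun_eq (f g : C) : f =1 g -> f = g.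
Proof. by move=> /funext fg; exact: val_inj. Qed.

End contfun_lmodule.

Section contfun_norm.
Context (R : realType) (K : topologicalType) (cptK : compact [set: K]).
Context (V : normedModType R).
Local Notation C := (contfun cptK V).

Definition supnorm (f : C) : R := sup (range (fun x => `|f x|)).

Lemma contfun_has_ubound (f : C) : has_ubound (range (fun x => `|f x|)).
Proof.
have /compact_bounded[M [_ Mf]] : compact (range f).
  by apply: continuous_compact => //; apply: continuous_subspaceT;
     exact: contfun_cts.
exists (M + 1) => _ [x _ <-].
by apply: (Mf (M + 1)); [rewrite ltrDl|exists x].
Qed.

Lemma ler_supnorm (f : C) x : `|f x| <= supnorm f.
Proof. by apply: ub_le_sup; [exact: contfun_has_ubound|exists x]. Qed.

Lemma supnorm_le (f : C) (M : R) :
  0 <= M -> (forall x, `|f x| <= M) -> supnorm f <= M.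
Proof.
move=> M0 fM; rewrite /supnorm.
have [->|fn0] := eqVneq (range (fun x => `|f x|)) set0; first by rewrite sup0.
by apply: ge_sup => [|_ [x _ <-]//]; exact/set0P.
Qed.

Lemma supnorm_ge0 (f : C) : 0 <= supnorm f.
Proof.
have [r0|/set0P[_ [x _ _]]] := eqVneq (range (fun x => `|f x|)) set0.
  by rewrite /supnorm r0 sup0.
exact: le_trans (normr_ge0 _) (ler_supnorm f x).
Qed.

Let supnormD (f g : C) : supnorm (f + g) <= supnorm f + supnorm g.
Proof.
apply: supnorm_le => [|x]; first by rewrite addr_ge0 ?supnorm_ge0.
by rewrite (le_trans (ler_normD _ _))// lerD// ler_supnorm.
Qed.

Let supnormZ (a : R) (f : C) : supnorm (a *: f) = `|a| * supnorm f.
Proof.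
have le b g : supnorm (b *: g) <= `|b| * supnorm g.
  apply: supnorm_le => [|x]; first by rewrite mulr_ge0 ?supnorm_ge0.
  by rewrite normrZ ler_wpM2l// ler_supnorm.
apply/eqP; rewrite eq_le le/=.
have [->|a0] := eqVneq a 0; first by rewrite normr0 mul0r supnorm_ge0.
rewrite -ler_pdivlMl ?normr_gt0// -normfV.
by have := le a^-1 (a *: f); rewrite scalerA mulVf// scale1r.
Qed.

Let supnorm0_eq0 (f : C) : supnorm f = 0 -> f = 0.
Proof.
move=> f0; apply: contfun_eq => x; apply/eqP.
by rewrite -normr_le0 -f0 ler_supnorm.
Qed.

HB.instance Definition _ := Lmodule_isNormed.Build R C
  supnormD supnormZ supnorm0_eq0.

End contfun_norm.

Section contfun_complete.
Context (R : realType) (K : topologicalType) (cptK : compact [set: K]).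
Context (V : completeNormedModType R).
Local Notation C := (contfun cptK V).

Let contfun_complete (F : set_system C) : ProperFilter F -> cauchy F -> cvg F.
Proof.
move=> FF Fc.
have Fe (e : R) : 0 < e -> exists2 A, F A &
    forall f g x, A f -> A g -> `|f x - g x| <= e.
  move=> e0; have e20 : 0 < e / 2 by rewrite divr_gt0.
  have [h Fh] := (cauchyP F).1 Fc _ e20; exists (ball h (e / 2)) => //.
  move=> f g x; rewrite -!ball_normE/= => hf hg.
  rewrite -(subrKA (h x)) (le_trans (ler_normD _ _))// (splitr e) lerD//.
    by rewrite distrC (le_trans (ler_supnorm (h - f) x))// ltW.
  by rewrite (le_trans (ler_supnorm (h - g) x))// ltW.
have cvF x : cvg ((fun f : C => f x) @ F).
  apply: cauchy_cvg; apply: cauchy_exP => e e0.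
  have e20 : 0 < e / 2 by rewrite divr_gt0.
  have [A FA Ae] := Fe _ e20; have [f Af] := filter_ex FA.
  exists (f x); suff : F [set g | ball (f x) e (g x)] by [].
  apply: filterS FA => g Ag; rewrite /= -ball_normE/=.
  by rewrite (le_lt_trans (Ae _ _ _ Af Ag))// ltr_pdivrMr// ltr_pMr// ltr1n.
pose l x := lim ((fun f : C => f x) @ F).
have Fl (e : R) : 0 < e -> exists2 A, F A &
    forall f x, A f -> `|l x - f x| <= e.
  move=> e0; have [A FA Af] := Fe _ e0; exists A => // f x Aff.
  apply/ler_addgt0Pl => d d0.
  have /cvgrPdist_lt/(_ _ d0) Fd := cvF x.
  have [g [gd Ag]] := filter_ex (filterI Fd FA).
  rewrite -(subrKA (g x)) (le_trans (ler_normD _ _))// lerD//; last exact: Af.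
  exact: ltW gd.
have cl : continuous l.
  move=> x; apply/cvgrPdist_le => e e0.
  have e30 : 0 < e / 3 by rewrite divr_gt0.
  have [A FA Al] := Fl _ e30; have [f Aff] := filter_ex FA.
  have /cvgrPdist_le/(_ _ e30) fx := @contfun_cts _ _ _ _ f x.
  near=> y.
  have xy : `|f x - f y| <= e / 3 by near: y.
  have ly : `|f y - l y| <= e / 3 by rewrite distrC Al.
  have -> : l x - l y = (l x - f x) + (f x - f y) + (f y - l y).
    by rewrite !subrKA.
  have -> : e = e / 3 + e / 3 + e / 3.
    by rewrite -!mulrDl -!mulr2n -mulrSr -[X in X / _]mulr_natr mulfK.
  rewrite (le_trans (ler_normD _ _))// lerD// (le_trans (ler_normD _ _))//.
  by rewrite lerD// Al.
apply/cvg_ex; exists (contfun_Sub cptK (mem_set cl)).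
apply/cvgrPdist_le => e e0; have [A FA Al] := Fl _ e0.
apply: filterS FA => f Aff; apply: supnorm_le; first exact: ltW.
by move=> x; exact: Al.
Unshelve. all: by end_near. Qed.

HB.instance Definition _ := Uniform_isComplete.Build C contfun_complete.

End contfun_complete.

Definition unit_sphere (R : realType) (X : normedModType R) : set X :=
  [set x | `|x| = 1].
Arguments unit_sphere {R} X.

Definition isometry_on (R : realType) (X Y : normedModType R) (A : set X)
  (f : X -> Y) := {in A &, forall x y, `|f x - f y| = `|x - y|}.

(* A map between the unit spheres is represented by a total function [D] of
   which only the restriction to the unit sphere of [X] matters. *)
Definition mazur_ulam (R : realType) (X : completeNormedModType R) : Prop :=
  forall (Y : completeNormedModType R) (D : X -> Y),
    set_fun (unit_sphere X) (unit_sphere Y) D ->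
    set_surj (unit_sphere X) (unit_sphere Y) D ->
    isometry_on (unit_sphere X) D ->
  exists T : {linear X -> Y},
    [/\ isometry_on [set: X] T,
        set_surj [set: X] [set: Y] T &
        {in unit_sphere X, T =1 D}].

(* Main.v *)
(** Antipodality at distance 2 shows, without any smoothness or separability
    assumption, that a surjective isometry D between unit spheres sends triples
    x, y, z with |x + y + z| = 3 to such triples.  Hence D maps the maximal face
    F(t, e) of functions f in the sphere with f(t) = e onto a convex set, and
    D(-f) = -D(f).  The distance from f to F(t, c) is |f(t) - c|, and the distance
    to a convex set is a convex function; since a point of the ball of H is
    determined by its distances to the two ends of a chord through it, D is affine
    on every face.

    Let q_{t,e} be the sublinear functional on Y attached to D(F(t, e)).  Affinity
    on a face at s <> t, moving from f towards a function vanishing at t, improves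
    the trivial bound q_{t,e}(D f) <= |f(t) + e| - 1 to q_{t,e}(D f) <= <f(t), e>.
    When K is a point there is no such s; there the norm of Y satisfies the
    parallelogram identity on unit vectors, which forces it to be Euclidean on
    planes.  The functionals q_{t,e} detect nonzero vectors, so applying them to
    T f + T g - T (f + g), where T is the positively homogeneous extension of D,
    shows that T is additive. *)
Require Import Defs.
From HB Require Import structures.
From mathcomp Require Import all_boot all_order all_algebra.
From mathcomp Require Import all_classical all_reals all_analysis.
From mathcomp Require Import ring lra.

Set Implicit Arguments.
Unset Strict Implicit.
Unset Printing Implicit Defensive.

Import Order.TTheory GRing.Theory Num.Theory.
Import numFieldNormedType.Exports.

Local Open Scope classical_set_scope.
Local Open Scope ring_scope.

(** * Linear identities in modules *)

Inductive lmod_expr (R : Type) : Type :=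
| LVar of nat
| LZero
| LAdd of lmod_expr R & lmod_expr R
| LOpp of lmod_expr R
| LScale of R & lmod_expr R.

Fixpoint lmod_eval (R : pzRingType) (V : lmodType R) (vs : seq V)
    (e : lmod_expr R) : V :=
  match e with
  | LVar i => nth 0 vs i
  | LZero => 0
  | LAdd e1 e2 => lmod_eval vs e1 + lmod_eval vs e2
  | LOpp e1 => - lmod_eval vs e1
  | LScale r e1 => r *: lmod_eval vs e1
  end.

(** [Nat.eqb] on numerals reduces under [cbn], so the coefficient goals left to [ring] or [field]
    contain no comparison of indices. *)
Fixpoint lmod_coef (R : pzRingType) (e : lmod_expr R) (i : nat) : R :=
  match e with
  | LVar j => if Nat.eqb i j then 1 else 0
  | LZero => 0
  | LAdd e1 e2 => lmod_coef e1 i + lmod_coef e2 i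
  | LOpp e1 => - lmod_coef e1 i
  | LScale r e1 => r * lmod_coef e1 i
  end.

Fixpoint lmod_coefs_eq (R : pzRingType) (e1 e2 : lmod_expr R) (n : nat) : Prop :=
  if n is n'.+1 then
    lmod_coef e1 n' = lmod_coef e2 n' /\ lmod_coefs_eq e1 e2 n'
  else True.

Lemma lmod_evalE (R : pzRingType) (V : lmodType R) (vs : seq V) e :
  lmod_eval vs e = \sum_(i < size vs) lmod_coef e i *: vs`_i.
Proof.
elim: e => [j||e1 IH1 e2 IH2|e IH|r e IH] /=.
- have eqbE (i : nat) : Nat.eqb i j = (i == j).
    by apply/idP/eqP => /PeanoNat.Nat.eqb_eq.
  have [jn|nj] := ltnP j (size vs).
    rewrite (bigD1 (Ordinal jn))//= eqbE eqxx scale1r big1 ?addr0// => i.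
    by rewrite -val_eqE/= eqbE => /negPf ->; rewrite scale0r.
  rewrite nth_default// big1// => i _; rewrite eqbE.
  by rewrite ltn_eqF ?scale0r// (leq_trans (ltn_ord i)).
- by rewrite big1// => i _; rewrite scale0r.
- by rewrite IH1 IH2 -big_split/=; apply: eq_bigr => i _; rewrite scalerDl.
- by rewrite IH -sumrN; apply: eq_bigr => i _; rewrite scaleNr.
- by rewrite IH scaler_sumr; apply: eq_bigr => i _; rewrite scalerA.
Qed.

Lemma lmod_evalP (R : pzRingType) (V : lmodType R) (vs : seq V) e1 e2 :
  lmod_coefs_eq e1 e2 (size vs) -> lmod_eval vs e1 = lmod_eval vs e2.
Proof.
move=> E; rewrite !lmod_evalE; apply: eq_bigr => i _; congr (_ *: _).
move: (nat_of_ord i) (ltn_ord i) => {i} i; elim: (size vs) E => //= n IH [En E].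
by rewrite ltnS leq_eqVlt => /predU1P[->//|]; exact: IH.
Qed.

Ltac lmod_index x vs :=
  lazymatch vs with
  | x :: _ => constr:(0%N)
  | _ :: ?vs' => let n := lmod_index x vs' in constr:(n.+1)
  end.

Ltac lmod_vars t vs :=
  lazymatch t with
  | ?a + ?b => let vs1 := lmod_vars a vs in lmod_vars b vs1
  | - ?a => lmod_vars a vs
  | _ *: ?a => lmod_vars a vs
  | 0 => vs
  (* The backtracking [match] adds [t] only when [lmod_index] fails to find it. *)
  | _ => match vs with
         | _ => let n := lmod_index t vs in vs
         | _ => constr:(t :: vs)
         end
  end.

Ltac lmod_reify R t vs :=
  lazymatch t with
  | ?a + ?b => let u := lmod_reify R a vs in let v := lmod_reify R b vs in
               constr:(LAdd u v)
  | - ?a => let u := lmod_reify R a vs in constr:(LOpp u)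
  | ?r *: ?a => let u := lmod_reify R a vs in constr:(LScale r u)
  | 0 => constr:(LZero R)
  | _ => let n := lmod_index t vs in constr:(LVar R n)
  end.

(* Linear identities in a left module, leaving the coefficients to [ring] or
   [field]. *)
Ltac lmod_eq_with R :=
  lazymatch goal with
  | |- ?t = ?u :> ?V =>
    let vs0 := lmod_vars t (@nil V) in
    let vs := lmod_vars u vs0 in
    let e1 := lmod_reify R t vs in
    let e2 := lmod_reify R u vs in
    apply: (@lmod_evalP _ _ vs e1 e2); cbn;
    repeat match goal with |- _ /\ _ => split end
  end.

Ltac lmod R := lmod_eq_with R; by [|ring|field].

(** * Geometry of a Hilbert space *)

Section inner_product.
Context (R : realType) (H : hilbertType R).
Implicit Types (a b u x y : H) (r s : R).
Local Notation "'[ x , y ]" := (inner x y).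

Lemma innerC x y : '[x, y] = '[y, x].
Proof. by rewrite hermC /= expr0 mul1r. Qed.

Lemma innerZl r x y : '[r *: x, y] = r * '[x, y].
Proof. by rewrite linearZl_LR. Qed.

Lemma innerDl x y a : '[x + y, a] = '[x, a] + '[y, a].
Proof. by rewrite linearDl. Qed.

Lemma innerZr r x y : '[x, r *: y] = r * '[x, y].
Proof. by rewrite innerC innerZl innerC. Qed.

Lemma innerDr a x y : '[a, x + y] = '[a, x] + '[a, y].
Proof. by rewrite innerC innerDl !(innerC a). Qed.

Lemma innerNl x y : '[- x, y] = - '[x, y].
Proof. by rewrite -scaleN1r innerZl mulN1r. Qed.

Lemma innerNr x y : '[x, - y] = - '[x, y].
Proof. by rewrite innerC innerNl innerC. Qed.

Lemma inner_norm x : '[x, x] = `|x| ^+ 2.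
Proof.
rewrite norm_inner sqr_sqrtr//; have [->|x0] := eqVneq x 0.
  by rewrite -[X in '[X, _]](scale0r (0 : H)) innerZl mul0r.
exact/ltW/neq0_dnorm_gt0.
Qed.

Let innerE := (innerDl, innerDr, innerNl, innerNr, innerZl, innerZr).

Lemma normD_sqr x y : `|x + y| ^+ 2 = `|x| ^+ 2 + 2 * '[x, y] + `|y| ^+ 2.
Proof. by rewrite -!inner_norm !innerE (innerC y x); ring. Qed.

Lemma normB_sqr x y : `|x - y| ^+ 2 = `|x| ^+ 2 - 2 * '[x, y] + `|y| ^+ 2.
Proof. by rewrite normD_sqr normrN innerNr; ring. Qed.

(** Strict convexity: the parallelogram identity bounds [|x - y|^2] by [2 + 2 - 4]. *)
Lemma norm_midpoint_eq x y : `|x| <= 1 -> `|y| <= 1 -> `|x + y| = 2 -> x = y.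
Proof.
move=> x1 y1 xy2; apply/eqP; rewrite -subr_eq0 -normr_eq0 -sqrf_eq0.
have := normD_sqr x y; rewrite xy2 normB_sqr => E.
have := sqr_ge0 `|x - y|; rewrite normB_sqr => ge0.
have := normr_ge0 x; have := normr_ge0 y => x0 y0.
by rewrite eq_le ge0 andbT; nra.
Qed.

(** The quadratic equation for [r] has discriminant [4 d], where [d] is at least the square of
    ['[a, u]]; hence its larger root is nonnegative. *)
Lemma ray_meets_sphere a u : `|a| <= 1 -> `|u| = 1 ->
  exists2 r, 0 <= r & `|a + r *: u| = 1.
Proof.
move=> a1 u1; pose d := '[a, u] ^+ 2 + (1 - `|a| ^+ 2).
have a2 : 0 <= 1 - `|a| ^+ 2 by rewrite subr_ge0 expr_le1.
have d0 : 0 <= d by rewrite addr_ge0 ?sqr_ge0.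
exists (Num.sqrt d - '[a, u]).
  rewrite subr_ge0 (le_trans (ler_norm _))// -sqrtr_sqr ler_wsqrtr//.
  by rewrite lerDl.
apply/eqP; rewrite -(@eqrXn2 _ 2)// expr1n normD_sqr normrZ u1 mulr1.
rewrite real_normK ?num_real// innerZr; apply/eqP.
by have := sqr_sqrtr d0; rewrite {2}/d => E; nra.
Qed.

(** Equality case of the triangle inequality: the second bound, squared and multiplied by [s], gives
    [L |x - s u|^2 <= (L - s) (|x|^2 - s^2) <= 0]. *)
Lemma triangle_eq_scale (s L : R) u x : `|u| = 1 -> 0 <= s <= L ->
  `|x| <= s -> `|L *: u - x| <= L - s -> x = s *: u.
Proof.
move=> u1 /andP[s0 sL] xs Lx.
have [L0|L0] := eqVneq L 0.
  have s0' : s = 0 by apply/eqP; rewrite eq_le s0 andbT -L0.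
  by move: xs; rewrite s0' normr_le0 scale0r => /eqP.
have Lgt0 : 0 < L by rewrite lt_neqAle eq_sym L0 (le_trans s0).
have : `|L *: u - x| ^+ 2 <= (L - s) ^+ 2.
  by rewrite lerXn2r// nnegrE ?subr_ge0.
rewrite normB_sqr innerZl normrZ u1 mulr1 real_normK ?num_real// => E.
have X : `|x| ^+ 2 <= s ^+ 2 by rewrite lerXn2r// nnegrE.
apply/eqP; rewrite -subr_eq0 -normr_eq0 -sqrf_eq0.
rewrite eq_le sqr_ge0 andbT -(pmulr_rle0 _ Lgt0).
rewrite normB_sqr innerZr normrZ u1 mulr1 real_normK ?num_real// (innerC x).
have := ler_wpM2l s0 E.
have : 0 <= (L - s) * (s ^+ 2 - `|x| ^+ 2) by rewrite mulr_ge0 ?subr_ge0.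
nra.
Qed.

(* The hypothesis is used only at the two points where the line through [a] and
   [b] meets the unit sphere. *)
Lemma sphere_dist_conv (t : R) a b x : (exists u : H, `|u| = 1) ->
  `|a| <= 1 -> `|b| <= 1 -> 0 <= t <= 1 ->
  (forall c, `|c| = 1 -> `|x - c| <= (1 - t) * `|a - c| + t * `|b - c|) ->
  x = (1 - t) *: a + t *: b.
Proof.
move=> exu a1 b1 /andP[t0 t1] xc.
(* For [a = b] the direction is arbitrary, and the assumed unit vector serves. *)
have [u [u1 ab]] : exists u : H, `|u| = 1 /\ b = a + `|b - a| *: u.
  have [->|ba] := eqVneq b a.
    by have [u u1] := exu; exists u; rewrite subrr normr0 scale0r addr0.
  exists (`|b - a|^-1 *: (b - a)); split.
    by rewrite normrZ normfV normr_id mulVf// normr_eq0 subr_eq0.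
  by rewrite scalerA divff ?normr_eq0 ?subr_eq0// scale1r addrC subrK.
set d := `|b - a| in ab; have d0 : 0 <= d by exact: normr_ge0.
(* The chord through [a] and [b] ends at [a - r u] and [b + s u]. *)
have [r r0 cr] := @ray_meets_sphere a (- u) a1 (etrans (normrN u) u1).
have [s s0 cs] := ray_meets_sphere b1 u1.
have nZ q : 0 <= q -> `|q *: u| = q.
  by move=> q0; rewrite normrZ u1 mulr1 ger0_norm.
have := xc _ cr; have := xc _ cs.
have -> : a - (b + s *: u) = - ((d + s) *: u) by rewrite ab; lmod R.
have -> : b - (b + s *: u) = - (s *: u) by lmod R.
have -> : a - (a + r *: - u) = r *: u by lmod R.
have -> : b - (a + r *: - u) = (d + r) *: u by rewrite ab; lmod R.
rewrite !normrN !nZ ?addr_ge0// => e1 e2.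
(* [y] is [x] measured from the first end. Its distance bounds to the two ends add up to the chord
   length [r + d + s], which forces [x] onto the chord. *)
pose y := x - (a + r *: - u).
have ys : `|y| <= r + t * d by rewrite /y (le_trans e2)//; nra.
have yL : `|(r + d + s) *: u - y| <= (r + d + s) - (r + t * d).
  have -> : (r + d + s) *: u - y = - (x - (b + s *: u)).
    by rewrite /y ab; lmod R.
  by rewrite normrN (le_trans e1)//; nra.
have : y = (r + t * d) *: u.
  apply: triangle_eq_scale yL => //; rewrite addr_ge0 ?mulr_ge0//=.
  by rewrite -addrA lerD2l; nra.
move=> /eqP; rewrite subr_eq => /eqP ->.
by rewrite ab; lmod R.
Qed.

(** For the norm [N] on the left, [0 <= (N - 1)^2] gives [N <= (1 + N^2) / 2]. The error is
    quadratic in [t], so it still vanishes in the limit after division by [t]. *)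
Lemma norm_unit_addZ_le (t : R) a x : `|a| = 1 -> `|x| <= 1 ->
  `|a + t *: x| <= 1 + t * '[x, a] + t ^+ 2 / 2.
Proof.
move=> a1 x1; have := sqr_ge0 (`|a + t *: x| - 1).
have := normD_sqr a (t *: x).
rewrite normrZ exprMn real_normK ?num_real// a1 innerZr (innerC a) => E.
have : t ^+ 2 * `|x| ^+ 2 <= t ^+ 2 * 1.
  by rewrite ler_wpM2l ?sqr_ge0// expr_le1.
nra.
Qed.

End inner_product.

(** * Isometries between unit spheres *)

Section sphere_isometry.
Context (R : realType).

(** [(r + s + t) (x + y + z)] is this combination plus the one with complementary coefficients. Its
    norm equals the sum of the two trivial upper bounds, so neither can be strict. *)
Lemma norm_cone3 (V : normedModType R) (x y z : V) (r s t : R) :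
  `|x| = 1 -> `|y| = 1 -> `|z| = 1 -> `|x + y + z| = 3 ->
  0 <= r -> 0 <= s -> 0 <= t -> `|r *: x + s *: y + t *: z| = r + s + t.
Proof.
move=> x1 y1 z1 xyz r0 s0 t0; apply/eqP; rewrite eq_le; apply/andP; split.
  rewrite (le_trans (ler_normD _ _))// lerD//.
    rewrite (le_trans (ler_normD _ _))// !normrZ x1 y1 !mulr1 !ger0_norm//.
  by rewrite normrZ z1 mulr1 ger0_norm.
pose M := r + s + t.
have M0 : 0 <= M by rewrite !addr_ge0.
have : `|M *: (x + y + z)| = M * 3 by rewrite normrZ xyz ger0_norm.
have -> : M *: (x + y + z) = (r *: x + s *: y + t *: z) +
  ((s + t) *: x + (r + t) *: y + (r + s) *: z) by rewrite /M; lmod R.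
move=> E; have := ler_normD (r *: x + s *: y + t *: z)
  ((s + t) *: x + (r + t) *: y + (r + s) *: z).
have : `|(s + t) *: x + (r + t) *: y + (r + s) *: z| <=
  (s + t) + (r + t) + (r + s).
  rewrite (le_trans (ler_normD _ _))// lerD//.
    by rewrite (le_trans (ler_normD _ _))// !normrZ x1 y1 !mulr1
      !ger0_norm ?addr_ge0.
  by rewrite normrZ z1 mulr1 ger0_norm ?addr_ge0.
by rewrite E /M; lra.
Qed.

Lemma norm_cone2 (V : normedModType R) (x y : V) (r s : R) :
  `|x| = 1 -> `|y| = 1 -> `|x + y| = 2 ->
  0 <= r -> 0 <= s -> `|r *: x + s *: y| = r + s.
Proof.
move=> x1 y1 xy r0 s0.
have E : `|(r + s) *: (x + y)| = (r + s) * 2.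
  by rewrite normrZ xy ger0_norm ?addr_ge0.
have := ler_normD (r *: x + s *: y) (s *: x + r *: y).
have -> : r *: x + s *: y + (s *: x + r *: y) = (r + s) *: (x + y) by lmod R.
have nD p q : 0 <= p -> 0 <= q -> `|p *: x + q *: y| <= p + q.
  move=> p0 q0; rewrite (le_trans (ler_normD _ _))// !normrZ x1 y1 !mulr1.
  by rewrite !ger0_norm.
rewrite E; have := nD _ _ r0 s0; have := nD _ _ s0 r0.
by move=> h1 h2 h3; apply/eqP; rewrite eq_le h2/=; lra.
Qed.

(** * Sums of maximal norm under a surjective isometry of spheres *)

Context (X Y : normedModType R) (D : X -> Y).
Hypothesis D_sphere : forall x, `|x| = 1 -> `|D x| = 1.
Hypothesis D_surj : forall y, `|y| = 1 -> exists2 x, `|x| = 1 & D x = y.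
Hypothesis D_isom : forall x y, `|x| = 1 -> `|y| = 1 -> `|D x - D y| = `|x - y|.

Lemma norm_avg3_dist (V : normedModType R) (x y z h : V) :
  `|x| = 1 -> `|y| = 1 -> `|z| = 1 -> `|h| = 1 ->
  `|3^-1 *: (x + y + z) - h| = 2 ->
  [/\ `|x - h| = 2, `|y - h| = 2 & `|z - h| = 2].
Proof.
move=> x1 y1 z1 h1 E.
have le2 (v : V) : `|v| = 1 -> `|v - h| <= 2.
  by move=> v1; rewrite (le_trans (ler_normB _ _))// v1 h1.
have : `|(x - h) + (y - h) + (z - h)| = 6.
  have -> : (x - h) + (y - h) + (z - h) = 3 *: (3^-1 *: (x + y + z) - h).
    by lmod R.
  by rewrite normrZ E ger0_norm//; lra.
have := ler_normD (x - h + (y - h)) (z - h).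
have := ler_normD (x - h) (y - h).
have := le2 _ x1; have := le2 _ y1; have := le2 _ z1.
by move=> a b c d e f; split; apply/eqP; rewrite eq_le; apply/andP; split; lra.
Qed.

(* With [f] the average of the three points, being at distance 2 from [f] implies
   being at distance 2 from each of them, and this passes to the images.  In the
   target one then averages with [D x], [D y], [D z] one at a time. *)
Lemma sphere_isometry_norm3 x y z : `|x| = 1 -> `|y| = 1 -> `|z| = 1 ->
  `|x + y + z| = 3 -> `|D x + D y + D z| = 3.
Proof.
move=> x1 y1 z1 xyz.
pose f := 3^-1 *: (x + y + z).
have f1 : `|f| = 1 by rewrite normrZ xyz ger0_norm ?invr_ge0// mulVf.
have far w : `|w| = 1 -> `|D f - w| = 2 ->
    [/\ `|D x - w| = 2, `|D y - w| = 2 & `|D z - w| = 2].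
  move=> w1; have [h h1 <-] := D_surj w1; rewrite !D_isom// => fh.
  exact: norm_avg3_dist fh.
have far' w : `|w| = 1 -> `|D f + w| = 2 ->
    [/\ `|D x + w| = 2, `|D y + w| = 2 & `|D z + w| = 2].
  by move=> w1 fw; have := far (- w); rewrite normrN !opprK; exact.
have avg (a b : Y) : `|a + b| = 2 -> `|2^-1 *: (a + b)| = 1.
  by move=> ab; rewrite normrZ ab ger0_norm ?invr_ge0// mulVf.
have Df1 := D_sphere f1; have Dx1 := D_sphere x1.
have Dy1 := D_sphere y1; have Dz1 := D_sphere z1.
have le1 r (a : Y) : 0 <= r -> `|a| = 1 -> `|r *: a| <= r.
  by move=> r0 a1; rewrite normrZ a1 mulr1 ger0_norm.
have [xf _ _] : [/\ `|D x + D f| = 2, `|D y + D f| = 2 & `|D z + D f| = 2].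
  by apply: far' => //; rewrite -mulr2n normrMn Df1.
have u1 := avg _ _ xf; set u := 2^-1 *: (D x + D f) in u1.
have [_ yu _] : [/\ `|D x + u| = 2, `|D y + u| = 2 & `|D z + u| = 2].
  apply: far' => //.
  have -> : D f + u = 2^-1 *: D x + (3 / 2) *: D f by rewrite /u; lmod R.
  by rewrite norm_cone2//; lra.
have v1 := avg _ _ yu; set v := 2^-1 *: (D y + u) in v1.
have [_ _ zv] : [/\ `|D x + v| = 2, `|D y + v| = 2 & `|D z + v| = 2].
  apply: far' => //; apply/eqP; rewrite eq_le; apply/andP; split.
    by rewrite (le_trans (ler_normD _ _))// Df1 v1.
  have E : `|5 *: v| = 5 by rewrite normrZ v1 mulr1 ger0_norm.
  (* Since [4 v = D x + 2 D y + D f], the norm 5 of [5 v] leaves at least 2 for [D f + v]. *)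
  have F : 5 *: v = (D f + v) + (D x + 2 *: D y).
    by rewrite /v /u; lmod R.
  have := ler_normD (D f + v) (D x + 2 *: D y).
  have := ler_normD (D x) (2 *: D y).
  by rewrite -F E normrZ Dx1 Dy1 ger0_norm//; lra.
apply/eqP; rewrite eq_le; apply/andP; split.
  have := ler_normD (D x + D y) (D z); have := ler_normD (D x) (D y).
  by rewrite Dx1 Dy1 Dz1; lra.
have E : `|4 *: (D z + v)| = 8 by rewrite normrZ zv ger0_norm//; lra.
(* The total has norm 8 and the last bracket at most 5, which leaves at least 3. *)
have F : 4 *: (D z + v) = (D x + D y + D z) + (3 *: D z + D y + D f).
  by rewrite /v /u; lmod R.
have := ler_normD (D x + D y + D z) (3 *: D z + D y + D f).
have := ler_normD (3 *: D z + D y) (D f); have := ler_normD (3 *: D z) (D y).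
have := le1 3 (D z); rewrite -F E Dz1 Dy1 Df1.
by move=> /(_ (ler0n _ _) erefl); lra.
Qed.

Lemma sphere_isometry_norm2 x y : `|x| = 1 -> `|y| = 1 ->
  `|x + y| = 2 -> `|D x + D y| = 2.
Proof.
move=> x1 y1 xy.
have : `|D x + D x + D y| = 3.
  apply: sphere_isometry_norm3 => //.
  have -> : x + x + y = 2 *: x + 1 *: y by lmod R.
  by rewrite norm_cone2//; lra.
have Dx1 := D_sphere x1; have Dy1 := D_sphere y1.
have := ler_normD (D x) (D x + D y); have := ler_normD (D x) (D y).
rewrite addrA Dx1 Dy1 => h1 h2 h3.
by apply/eqP; rewrite eq_le; apply/andP; split; lra.
Qed.

Lemma sphere_isometry_inj x y : `|x| = 1 -> `|y| = 1 -> D x = D y -> x = y.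
Proof.
move=> x1 y1 xy; apply/eqP; rewrite -subr_eq0 -normr_eq0 -D_isom// xy subrr.
by rewrite normr0.
Qed.

End sphere_isometry.

(** The inverse of [D] between the spheres is again a surjective isometry, to which the direct
    statement applies. *)
Lemma sphere_isometry_norm2_inv (R : realType) (X Y : normedModType R)
    (D : X -> Y) (x y : X) :
  (forall x, `|x| = 1 -> `|D x| = 1) ->
  (forall y, `|y| = 1 -> exists2 x, `|x| = 1 & D x = y) ->
  (forall x y, `|x| = 1 -> `|y| = 1 -> `|D x - D y| = `|x - y|) ->
  `|x| = 1 -> `|y| = 1 -> `|D x + D y| = 2 -> `|x + y| = 2.
Proof.
move=> D_sphere D_surj D_isom x1 y1 Dxy.
have /choice[D' D'P] : forall y : Y, exists x : X,
    `|y| = 1 -> `|x| = 1 /\ D x = y.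
  move=> z.
  (* Off the sphere [D'] takes a dummy value. *)
  have [z1|z1] := pselect (`|z| = 1); last by exists 0.
  by have [w w1 wz] := D_surj _ z1; exists w.
have D'D z : `|z| = 1 -> D' (D z) = z.
  move=> z1; have [z'1 z'D] := D'P _ (D_sphere _ z1).
  exact: (sphere_isometry_inj D_isom).
rewrite -(D'D x)// -(D'D y)//.
apply: sphere_isometry_norm2 => //; try exact: D_sphere.
- by move=> z /D'P[].
- by move=> z z1; exists (D z); [exact: D_sphere|exact: D'D].
- move=> z w z1 w1; have [z2 z3] := D'P _ z1; have [w2 w3] := D'P _ w1.
  by rewrite -[in RHS]z3 -[in RHS]w3 D_isom.
Qed.

(** * Planes with the parallelogram identity on unit vectors *)

Section unit_parallelogram.
Context (R : realType) (Y : normedModType R).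
Hypothesis parallelogram : forall p q : Y, `|p| = 1 -> `|q| = 1 ->
  `|p + q| ^+ 2 + `|p - q| ^+ 2 = 4.
Context (P Q : Y).
Hypotheses (P1 : `|P| = 1) (Q1 : `|Q| = 1) (PQ : `|P + Q| ^+ 2 = 2).

(** For orthonormal [P] and [Q] this would trace the unit circle of their plane. [Z] also records
    the quarter turn, so that good angles are stable under right-angle rotation. *)
Let u (x : R) : Y := cos x *: P + sin x *: Q.
Let Z (x : R) := `|u x| = 1 /\ `|u (x + pi / 2)| = 1.

Let u_quarter x : u (x + pi / 2) = cos x *: Q - sin x *: P.
Proof. by rewrite /u cosDpihalf sinDpihalf; lmod R. Qed.

Let u_half x : u (x + pi / 2 + pi / 2) = - u x.
Proof. by rewrite u_quarter cosDpihalf sinDpihalf /u; lmod R. Qed.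

Let Z_quarter x : Z x -> Z (x + pi / 2).
Proof. by move=> [x1 x2]; split => //; rewrite u_half normrN. Qed.

Let u_mid x d : u (x + d + d) + u x = (2 * cos d) *: u (x + d).
Proof.
have -> : x = (x + d) - d by ring.
rewrite subrK; move: (x + d) => y; rewrite /u cosB sinB cosD sinD; lmod R.
Qed.

Let u_diff x d : u (x + d + d) - u x = (2 * sin d) *: u (x + d + pi / 2).
Proof.
have -> : x = (x + d) - d by ring.
rewrite subrK; move: (x + d) => y.
by rewrite u_quarter /u cosB sinB cosD sinD; lmod R.
Qed.

Let u_parallelogram x d : `|u x| = 1 -> `|u (x + d + d)| = 1 ->
  cos d ^+ 2 * `|u (x + d)| ^+ 2 + sin d ^+ 2 * `|u (x + d + pi / 2)| ^+ 2 = 1.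
Proof.
move=> x1 y1; have := parallelogram y1 x1.
rewrite u_mid u_diff !normrZ !exprMn !real_normK ?num_real// => E.
lra.
Qed.

(* Applied to the pair at angles [x], [x + 2d] and to the same pair turned by a
   right angle, the parallelogram identity is a linear system in the squared
   norms at [x + d] and [x + d + pi / 2], of determinant [cos (2 d)]. *)
Let Z_mid x d : cos (d + d) != 0 -> Z x -> Z (x + d + d) -> Z (x + d).
Proof.
move=> cd [x1 x2] [y1 y2].
have := u_parallelogram x1 y1.
have := @u_parallelogram (x + pi / 2) d x2.
have -> : x + pi / 2 + d + d = x + d + d + pi / 2 by ring.
have -> : x + pi / 2 + d = x + d + pi / 2 by ring.
move=> /(_ y2); rewrite u_half normrN.
have := cos2Dsin2 d; move: cd; rewrite cosD -!expr2.
set a := cos d ^+ 2; set b := sin d ^+ 2 => ab ab1.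
set A := `|u (x + d)|; set B := `|u (x + d + pi / 2)| => E1 E2.
have AB : A ^+ 2 = B ^+ 2 by apply: (mulfI ab); lra.
have B2 : B ^+ 2 = 1 by rewrite -[LHS]mul1r -ab1 mulrDl -{1}AB; lra.
by split; apply/eqP; rewrite -(@eqrXn2 _ 2) ?normr_ge0// expr1n -?/A ?AB ?B2.
Qed.

Let Z0 : Z 0.
Proof. by split; rewrite ?u_quarter /u cos0 sin0 scale1r scale0r ?addr0 ?subr0. Qed.

(** Bisecting the angles 0 and [pi / 2] is the case where the determinant of [Z_mid] vanishes; the
    hypothesis [PQ] supplies this midpoint instead. *)
Let Z_eighth : Z (pi / 4).
Proof.
have E : pi / 4 + pi / 4 = pi / 2 :> R by field.
have := cos2Dsin2 (pi / 4 : R); have := cosD (pi / 4 : R) (pi / 4).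
rewrite E cos_pihalf -!expr2.
set a := cos _; set b := sin _ => ab ab1.
have a2 : a ^+ 2 = 2^-1 by lra.
have b2 : b ^+ 2 = 2^-1 by lra.
have PQ' := parallelogram P1 Q1; rewrite PQ in PQ'.
have := u_mid 0 (pi / 4); have := u_diff 0 (pi / 4).
rewrite !add0r E -[pi / 2]add0r u_quarter !add0r /u !cos0 !sin0 !scale1r !scale0r.
rewrite !subr0 !addr0 -/(u _) -/(u _) -/a -/b.
move=> /(congr1 (fun v : Y => `|v| ^+ 2)); rewrite distrC normrZ exprMn.
rewrite real_normK ?num_real// => E2.
move=> /(congr1 (fun v : Y => `|v| ^+ 2)); rewrite addrC PQ normrZ exprMn.
rewrite real_normK ?num_real// => E1.
by split; apply/eqP; rewrite -(@eqrXn2 _ 2) ?normr_ge0// expr1n; apply/eqP; nra.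
Qed.

(** Each step halves the mesh: even multiples are old angles, odd ones are midpoints. *)
Let Z_dyadic n k : Z (k%:R * (pi / (2 ^+ n.+2))).
Proof.
elim: n k => [k|n IH k].
  have -> : (2 : R) ^+ 2 = 4 by ring.
  (* Two consecutive multiples are carried because a quarter turn advances the index by two. *)
  suff : Z (k%:R * (pi / 4)) /\ Z (k.+1%:R * (pi / 4)) by case.
  elim: k => [|k [Zk ZSk]]; first by rewrite mul0r mul1r.
  split=> //; have -> : k.+2%:R * (pi / 4) = k%:R * (pi / 4) + pi / 2 :> R.
    by rewrite -(addn2 k) natrD; field.
  exact: Z_quarter.
have [j [->|->]] : exists j, k = j.*2 \/ k = j.*2.+1.
  by exists k./2; have := odd_double_half k; case: odd; [right|left].
  have -> : j.*2%:R * (pi / 2 ^+ n.+3) = j%:R * (pi / 2 ^+ n.+2) :> R.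
    by rewrite -muln2 natrM exprS; field; rewrite expf_neq0.
  exact: IH.
set d : R := pi / 2 ^+ n.+3.
have dd : d + d = pi / 2 ^+ n.+2.
  by rewrite /d exprS; field; rewrite expf_neq0.
have -> : j.*2.+1%:R * d = j%:R * (pi / 2 ^+ n.+2) + d.
  by rewrite -dd -addn1 natrD -muln2 natrM; ring.
apply: Z_mid; last 2 first.
- exact: IH.
- by rewrite -addrA dd -[X in _ + X]mul1r -mulrDl natr1; exact: IH.
(* [d + d] is at most [pi / 4], so the determinant in [Z_mid] is positive. *)
rewrite dd gt_eqF// cos_gt0_pihalf//.
have pi0 := pi_gt0 R.
have p0 : 0 < pi / 2 ^+ n.+2 :> R by rewrite divr_gt0// exprn_gt0.
apply/andP; split; first by rewrite (lt_trans _ p0)// oppr_lt0 divr_gt0.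
rewrite ltr_pM2l// ltf_pV2 ?posrE ?exprn_gt0// exprS ltr_pMr//.
by rewrite exprn_egt1// ltr1n.
Qed.

(** Dyadic angles are dense in the half-line and [u] is continuous. *)
Let norm_u x : 0 <= x -> `|u x| = 1.
Proof.
move=> x0; apply/eqP; apply: contraT => ux.
have cu : (fun y => `|u y| - 1) @ x --> `|u x| - 1.
  apply: cvgB; last exact: cvg_cst.
  apply: cvg_norm; apply: cvgD; apply: cvgZr_tmp.
    exact: continuous_cos.
  exact: continuous_sin.
have /nbhs_ballP[e /= e0 xe] : \forall y \near x, `|u y| - 1 != 0.
  by apply: cvgr_neq0 cu _; rewrite subr_eq0.
(* This makes the mesh [pi / 2^(n + 2)] finer than [e], so the last grid point not above [x] lies in
   the ball. *)
pose n := Num.bound (pi / e).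
have ne : pi / 2 ^+ n.+2 < e.
  rewrite ltr_pdivrMr ?exprn_gt0// mulrC -ltr_pdivrMr//.
  by rewrite upper_nthrootP// -addn2 leq_addr.
set d := pi / 2 ^+ n.+2 in ne; have d0 : 0 < d.
  by rewrite divr_gt0// ?pi_gt0// exprn_gt0.
have /andP[k1 k2] := truncn_itv (divr_ge0 x0 (ltW d0)).
set k := Num.truncn (x / d) in k1 k2.
have [] := Z_dyadic n k; rewrite -/d => Zk _.
suff /xe : ball x e (k%:R * d) by rewrite /= Zk subrr eqxx.
rewrite /ball/=; rewrite ler_pdivlMr// in k1; rewrite ltr_pdivrMr// -natr1 in k2.
by rewrite ger0_norm ?subr_ge0// (lt_trans _ ne)//; lra.
Qed.

Lemma unit_parallelogram_norm a b : a ^+ 2 + b ^+ 2 = 1 ->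
  `|a *: P + b *: Q| = 1.
Proof.
(* [acos] only reaches angles with nonnegative sine; changing both signs preserves the norm. *)
wlog b0 : a b / 0 <= b.
  move=> H E; have [|/ltW b0] := leP 0 b; first by move=> /H; exact.
  have := H (- a) (- b); rewrite oppr_ge0 !sqrrN => /(_ b0 E) <-.
  by rewrite -normrN; congr `|_|; lmod R.
move=> E; have a1 : -1 <= a <= 1.
  by apply/andP; split; nra.
have -> : a = cos (acos a) by rewrite acosK// in_itv.
have -> : b = sin (acos a).
  rewrite sin_acos//; apply/eqP.
  by rewrite -(@eqrXn2 _ 2) ?sqrtr_ge0// sqr_sqrtr; [apply/eqP; lra|nra].
by apply: norm_u; exact: acos_ge0.
Qed.

Lemma unit_parallelogram_normE a b : `|a *: P + b *: Q| ^+ 2 = a ^+ 2 + b ^+ 2.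
Proof.
pose r := Num.sqrt (a ^+ 2 + b ^+ 2).
have s0 : 0 <= a ^+ 2 + b ^+ 2 by rewrite addr_ge0 ?sqr_ge0.
have [ab0|ab0] := eqVneq (a ^+ 2 + b ^+ 2) 0.
  have a0 : a = 0 by apply/eqP; rewrite -sqrf_eq0; apply/eqP; nra.
  have b0 : b = 0 by apply/eqP; rewrite -sqrf_eq0; apply/eqP; nra.
  by rewrite a0 b0 !scale0r addr0 normr0 expr0n addr0.
have r0 : 0 < r by rewrite sqrtr_gt0 lt_neqAle eq_sym ab0.
have r2 : r ^+ 2 = a ^+ 2 + b ^+ 2 by rewrite sqr_sqrtr.
have -> : a *: P + b *: Q = r *: ((a / r) *: P + (b / r) *: Q).
  have rn := lt0r_neq0 r0.
  by lmod R.
rewrite normrZ unit_parallelogram_norm ?mulr1 ?real_normK ?num_real//.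
by rewrite !exprMn -mulrDl -r2 exprVn divff// expf_neq0// gt_eqF.
Qed.

End unit_parallelogram.

(** * Continuous functions on a compact space *)

Section contfun_bump.
Context (R : realType) (K : topologicalType).
Hypotheses (cptK : compact [set: K]) (hausK : hausdorff_space K).
Context (V : normedModType R).
Local Notation C := (contfun cptK V).
Implicit Types (f g : C) (t s : K).

Lemma contfunD f g x : contfun_fun (f + g) x = f x + g x. Proof. by []. Qed.
Lemma contfunN f x : contfun_fun (- f) x = - f x. Proof. by []. Qed.
Lemma contfunZ (r : R) f x : contfun_fun (r *: f) x = r *: f x. Proof. by []. Qed.

Lemma contfun_ext f g :
  (forall x, contfun_fun f x = contfun_fun g x) -> f = g.
Proof. exact: contfun_eq. Qed.

Lemma contfun_norm_ge f x : `|f x| <= `|f|.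
Proof. exact: ler_supnorm. Qed.

Lemma contfun_norm_le f (M : R) :
  0 <= M -> (forall x, `|f x| <= M) -> `|f| <= M.
Proof. exact: supnorm_le. Qed.

Lemma contfun_norm_attained f : f != 0 -> exists x, `|f x| = `|f|.
Proof.
move=> f0; have [K0|/set0P K0] := eqVneq [set: K] set0.
  case/eqP: f0; apply: contfun_eq => x; exfalso.
  by have : [set: K] x by []; rewrite K0.
have cf : {within [set: K], continuous (fun x => `|f x|)}.
  apply: continuous_subspaceT => x; apply: cvg_norm; exact: contfun_cts.
have [x _ xmax] := compact_EVT_max K0 cptK cf.
exists x; apply/eqP; rewrite eq_le contfun_norm_ge/=.
by apply: contfun_norm_le => // y; apply: xmax; rewrite inE.
Qed.

Lemma contfun_of (g : K -> V) : continuous g -> exists f : C, f =1 g.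
Proof. by move=> cg; exists (contfun_Sub cptK (mem_set cg)). Qed.

Lemma contfun_cst (v : V) : exists f : C, forall x, f x = v.
Proof. by apply: contfun_of => x; exact: cvg_cst. Qed.

(** Urysohn's lemma in the normal space [K], separating [t] from the complement of the interior of
    [U]. *)
Lemma bump t (U : set K) : nbhs t U -> exists w : K -> R,
  [/\ continuous w, forall x, 0 <= w x <= 1, w t = 1 &
      forall x, ~ U x -> w x = 0].
Proof.
move=> Ut; have nK := compact_normal hausK cptK.
have us : uniform_separator (~` U^°) [set t].
  apply: (proj1 (@normal_separatorP R K) nK).
  - exact/open_closedC/open_interior.
  - apply: accessible_closed_set1; exact: hausdorff_accessible.
  - apply/disjoints_subset => x /= xU xt; apply: xU; rewrite xt.
    exact: Ut.
have [w [cw w01 w0 w1]] := proj1 (@uniform_separatorP K R _ _) us; exists w; split => //.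
- by move=> x; have := w01 (w x); rewrite /= in_itv/=; apply; exists x.
- by apply: w1; exists t.
- move=> x Ux; apply: w0; exists x => //= xU; apply: Ux.
  exact: interior_subset xU.
Qed.

Lemma contfun_mix (w : K -> R) f g : continuous w ->
  exists h : C, forall x, h x = (1 - w x) *: f x + w x *: g x.
Proof.
move=> cw; apply: contfun_of => x; apply: cvgD; apply: cvgZ.
- by apply: cvgB; [exact: cvg_cst|exact: cw].
- exact: contfun_cts.
- exact: cw.
- exact: contfun_cts.
Qed.

Lemma norm_mix_le (r M : R) (u v : V) : 0 <= r <= 1 ->
  `|u| <= M -> `|v| <= M -> `|(1 - r) *: u + r *: v| <= M.
Proof.
move=> /andP[r0 r1] uM vM; rewrite (le_trans (ler_normD _ _))// !normrZ.
rewrite !ger0_norm ?subr_ge0//.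
have := ler_wpM2l r0 vM; have : (1 - r) * `|u| <= (1 - r) * M.
  by rewrite ler_wpM2l ?subr_ge0.
lra.
Qed.

End contfun_bump.

Definition contfunE := (@contfunD, @contfunN, @contfunZ).

(** * Faces of the unit sphere *)

Section face.
Context (R : realType) (K : topologicalType).
Hypotheses (cptK : compact [set: K]) (hausK : hausdorff_space K).
Context (H : hilbertType R).
Local Notation C := (contfun cptK H).
Implicit Types (f g h : C) (t s : K) (e c v : H).

Definition face t e : set C := [set f : C | `|f| = 1 /\ f t = e].

Lemma face_norm1 f t e : `|e| = 1 -> `|f| <= 1 -> f t = e -> face t e f.
Proof.
move=> e1 f1 fte; split => //; apply/eqP; rewrite eq_le f1/=.
by rewrite -e1 -fte contfun_norm_ge.
Qed.

Lemma face_cst t e : `|e| = 1 -> exists2 f : C, face t e f & forall x, f x = e.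
Proof.
move=> e1; have [f fe] := contfun_cst cptK e; exists f => //.
by apply: face_norm1 => //; apply: contfun_norm_le => // x; rewrite fe e1.
Qed.

Lemma near_close f t (eps : R) : 0 < eps -> \forall x \near t, `|f x - f t| <= eps.
Proof.
move=> e0; have /cvgrPdist_le/(_ _ e0) := @contfun_cts _ _ _ _ f t.
by apply: filterS => x; rewrite distrC.
Qed.

(** [f] is blended into the constant [c] by a bump supported where [f] stays within [eps] of [f t].
    Evaluation at [t] shows that the bound is sharp up to [eps]. *)
Lemma face_dist f t c (eps : R) : `|f| <= 1 -> `|c| = 1 -> 0 < eps ->
  exists2 g : C, face t c g & `|f - g| <= `|f t - c| + eps.
Proof.
move=> f1 c1 e0; have [w [cw w01 wt w0]] := bump R cptK hausK (near_close f t e0).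
have [k kc] := contfun_cst cptK c.
have [g gE] := contfun_mix f k cw; exists g.
  apply: face_norm1 => //; last by rewrite gE wt kc subrr scale0r scale1r add0r.
  apply: contfun_norm_le => // x; rewrite gE norm_mix_le ?kc ?c1//.
  exact: le_trans (contfun_norm_ge f x) f1.
apply: contfun_norm_le => [|x]; first by rewrite addr_ge0// ltW.
rewrite !contfunE gE kc.
have -> : f x - ((1 - w x) *: f x + w x *: c) = w x *: (f x - c) by lmod R.
have /andP[wx0 wx1] := w01 x.
have [xU|/w0 ->] := pselect (`|f x - f t| <= eps); last first.
  by rewrite scale0r normr0 addr_ge0// ltW.
rewrite normrZ ger0_norm// (le_trans (ler_piMl _ wx1))//.
have -> : f x - c = (f t - c) + (f x - f t) by lmod R.
by rewrite (le_trans (ler_normD _ _))// lerD2l.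
Qed.

(** If [h t] differs from [e], take [g = w e] with [w] supported where [h] differs from [e]. Where
    [h + g] attains norm 2, strict convexity gives [h x = g x = e], a contradiction. *)
Lemma face_char h t e : `|h| = 1 -> `|e| = 1 ->
  (forall g, face t e g -> `|h + g| = 2) -> h t = e.
Proof.
move=> h1 e1 hg; apply/eqP; apply: contraT => hte.
have cU : (fun x => h x - e) @ t --> h t - e.
  by apply: cvgB; [exact: contfun_cts|exact: cvg_cst].
have Ut : \forall x \near t, h x - e != 0.
  by apply: cvgr_neq0 cU _; rewrite subr_eq0.
have [w [cw w01 wt w0]] := bump R cptK hausK Ut.
have [k kc] := contfun_cst cptK e.
have [g gE] := contfun_mix 0 k cw.
have gx x : g x = w x *: e by rewrite gE kc scaler0 add0r.
have g1 : `|g| <= 1.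
  apply: contfun_norm_le => // x; rewrite gx normrZ e1 mulr1.
  by have /andP[w0' w1] := w01 x; rewrite ger0_norm.
have gF : face t e g by apply: face_norm1 => //; rewrite gx wt scale1r.
have hg2 := hg _ gF.
have hg0 : h + g != 0 by rewrite -normr_eq0 hg2.
have [x] := contfun_norm_attained hg0; rewrite hg2 contfunE => hgx.
have hx1 : `|h x| <= 1 by rewrite -h1 contfun_norm_ge.
have gx1 : `|g x| <= 1 by rewrite (le_trans (contfun_norm_ge g x)).
have hgxE := norm_midpoint_eq hx1 gx1 hgx.
have wx : w x = 1.
  have /andP[wx0 wx1] := w01 x; apply/eqP; rewrite eq_le wx1/=.
  have := ler_normD (h x) (g x); rewrite hgx gx normrZ e1 mulr1 ger0_norm//.
  by move: hx1; lra.
have [|/w0] := pselect (h x - e != 0); last by rewrite wx => /eqP; rewrite oner_eq0.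
by rewrite hgxE gx wx scale1r subrr eqxx.
Qed.

(** * Images of faces under a surjective isometry *)

Context (Y : normedModType R) (D : C -> Y).
Hypothesis D_sphere : forall f : C, `|f| = 1 -> `|D f| = 1.
Hypothesis D_surj : forall y, `|y| = 1 -> exists2 f : C, `|f| = 1 & D f = y.
Hypothesis D_isom : forall f g : C,
  `|f| = 1 -> `|g| = 1 -> `|D f - D g| = `|f - g|.

(** Every [g] in the opposite face satisfies [|D h + D g| = |g - f| = 2], hence [|h + g| = 2], and
    [face_char] locates [h]. *)
Lemma antipode_face f t e : `|e| = 1 -> face t e f ->
  exists2 h : C, face t (- e) h & D h = - D f.
Proof.
move=> e1 [f1 fte]; have [h h1 Dh] : exists2 h : C, `|h| = 1 & D h = - D f.
  by apply: D_surj; rewrite normrN D_sphere.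
exists h => //; split => //; apply: face_char; rewrite ?normrN// => g [g1 gte].
apply: (sphere_isometry_norm2_inv D_sphere) => //.
rewrite Dh addrC D_isom//; apply/eqP; rewrite eq_le; apply/andP; split.
  by rewrite (le_trans (ler_normB _ _))// f1 g1.
rewrite (le_trans _ (contfun_norm_ge (g - f) t))// !contfunE gte fte.
by rewrite -opprD normrN -mulr2n normrMn e1.
Qed.

Lemma face_sum3 f g h t e : `|e| = 1 -> face t e f -> face t e g ->
  face t e h -> `|f + g + h| = 3.
Proof.
move=> e1 [f1 fe] [g1 ge] [h1 he]; apply/eqP; rewrite eq_le; apply/andP; split.
  rewrite (le_trans (ler_normD _ _))// h1 (le_trans (lerD (ler_normD _ _) (lexx _)))//.
  by rewrite f1 g1; lra.
rewrite (le_trans _ (contfun_norm_ge _ t))// !contfunE fe ge he.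
have -> : e + e + e = 3 *: e by lmod R.
by rewrite normrZ e1 ger0_norm// mulr1.
Qed.

Lemma face_image_sum3 f g h t e (p q r : R) : `|e| = 1 -> face t e f ->
  face t e g -> face t e h -> 0 <= p -> 0 <= q -> 0 <= r ->
  `|p *: D f + q *: D g + r *: D h| = p + q + r.
Proof.
move=> e1 Ff Fg Fh p0 q0 r0; have [[f1 _] [g1 _] [h1 _]] := And3 Ff Fg Fh.
apply: norm_cone3 => //; try exact: D_sphere.
by apply: sphere_isometry_norm3 => //; exact: face_sum3 Ff Fg Fh.
Qed.

(** The preimage of the combination has a sum of norm 2 with every member of the face, so
    [face_char] puts it in the face. *)
Lemma face_image_convex f g t e (r : R) : `|e| = 1 -> face t e f ->
  face t e g -> 0 <= r <= 1 ->
  exists2 h : C, face t e h & D h = (1 - r) *: D f + r *: D g.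
Proof.
move=> e1 Ff Fg /andP[r0 r1]; have r1' : 0 <= 1 - r by rewrite subr_ge0.
have [h h1 Dh] : exists2 h : C, `|h| = 1 & D h = (1 - r) *: D f + r *: D g.
  apply: D_surj; have := face_image_sum3 e1 Ff Fg Ff r1' r0 (lexx 0).
  by rewrite scale0r !addr0 subrK.
exists h => //; split => //; apply: face_char => // k Fk; have [k1 _] := Fk.
apply: (sphere_isometry_norm2_inv D_sphere) => //; rewrite Dh.
have := face_image_sum3 e1 Ff Fg Fk r1' r0 ler01.
by rewrite scale1r subrK.
Qed.

Lemma unit_value f : `|f| = 1 -> exists t, `|f t| = 1.
Proof.
move=> f1; have [|t ft] := @contfun_norm_attained _ _ cptK _ f; last first.
  by exists t; rewrite ft.
by rewrite -normr_eq0 f1 oner_eq0.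
Qed.

(** Faces and their antipodes show that [h t] is, for each unit [c], no farther from [c] than
    [- f t] is; [sphere_dist_conv] then identifies the two points. *)
Lemma sphere_isometry_opp f : `|f| = 1 -> D (- f) = - D f.
Proof.
move=> f1; have [h h1 Dh] : exists2 h : C, `|h| = 1 & D h = - D f.
  by apply: D_surj; rewrite normrN D_sphere.
suff -> : - f = h by [].
apply: contfun_ext => t; have [t0 ft0] := unit_value f1.
have ft1 : `|- f t| <= 1 by rewrite normrN -f1 contfun_norm_ge.
(* A degenerate combination, with weight 0 and equal endpoints, fits the form of
   [sphere_dist_conv]. *)
rewrite contfunE; suff -> : h t = (1 - 0) *: - f t + 0 *: - f t.
  by rewrite subr0 scale1r scale0r addr0.
apply: sphere_dist_conv => //; [by exists (f t0)|by rewrite lexx ler01|].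
move=> c c1; rewrite subr0 mul1r mul0r addr0; apply/ler_addgt0Pr => eps e0.
have [||g Fg fg] := @face_dist f t (- c) eps _ _ e0; rewrite ?f1 ?normrN//.
have [|k [k1 kt] Dk] := antipode_face _ Fg; rewrite ?normrN//.
move: kt; rewrite opprK => kt; rewrite -kt.
rewrite (le_trans (contfun_norm_ge (h - k) t))// -D_isom// Dh Dk.
rewrite -opprB normrN opprK addrC D_isom//; last by case: Fg.
by rewrite (le_trans fg)// opprK kt -opprD normrN.
Qed.

(* The distance to each convex set [D @` face t c] is convex, and by [face_dist]
   it controls [f t] through its distances to the unit vectors. *)
Lemma face_affine f g s v (r : R) : `|v| = 1 -> face s v f -> face s v g ->
  0 <= r <= 1 -> D ((1 - r) *: f + r *: g) = (1 - r) *: D f + r *: D g.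
Proof.
move=> v1 Ff Fg r01; have [h [h1 _] Dh] := face_image_convex v1 Ff Fg r01.
rewrite -Dh; congr D; apply: contfun_ext => t; rewrite !contfunE; apply/esym.
have [f1 _] := Ff; have [g1 _] := Fg.
apply: sphere_dist_conv => //; [by exists v|by rewrite -f1 contfun_norm_ge|
  by rewrite -g1 contfun_norm_ge|].
move=> c c1; apply/ler_addgt0Pr => eps e0.
have [|f' Ff' ff'] := @face_dist f t c eps _ c1 e0; first by rewrite f1.
have [|g' Fg' gg'] := @face_dist g t c eps _ c1 e0; first by rewrite g1.
have [k [k1 kt] Dk] := face_image_convex c1 Ff' Fg' r01.
rewrite -{1}kt (le_trans (contfun_norm_ge (h - k) t))// -D_isom// Dh Dk.
have -> : (1 - r) *: D f + r *: D g - ((1 - r) *: D f' + r *: D g') =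
   (1 - r) *: (D f - D f') + r *: (D g - D g') by lmod R.
case: Ff' Fg' => f'1 _ [g'1 _]; case/andP: r01 => r0 r1.
rewrite (le_trans (ler_normD _ _))// !normrZ !ger0_norm ?subr_ge0//.
rewrite !D_isom//; have := ler_wpM2l r0 gg'.
have : (1 - r) * `|f - f'| <= (1 - r) * (`|f t - c| + eps).
  by rewrite ler_wpM2l ?subr_ge0.
by lra.
Qed.

End face.

(** * The linear extension *)

Section extension.
Context (R : realType) (K : topologicalType).
Hypotheses (cptK : compact [set: K]) (hausK : hausdorff_space K).
Context (H : hilbertType R).
Local Notation C := (contfun cptK H).
Local Notation "'[ x , y ]" := (inner x y).
Context (Y : normedModType R) (D : C -> Y).
Hypothesis D_sphere : forall f : C, `|f| = 1 -> `|D f| = 1.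
Hypothesis D_surj : forall y, `|y| = 1 -> exists2 f : C, `|f| = 1 & D f = y.
Hypothesis D_isom : forall f g : C,
  `|f| = 1 -> `|g| = 1 -> `|D f - D g| = `|f - g|.
Implicit Types (f g h : C) (t s : K) (e c v : H) (y z : Y).

(* [face_le t e y r] says that the sublinear functional
   [y |-> inf_{g, p} `|y + p *: D g| - p], with [g] in [face t e] and [p >= 0],
   is at most [r] at [y]; a norm-one linear functional equal to 1 on
   [D @` face t e] is bounded by it. *)
Definition face_le t e y (r : R) := forall eps, 0 < eps ->
  exists g p, [/\ face t e g, 0 <= p & `|y + p *: D g| <= p + r + eps].

(** Convexity of the image of the face merges [p *: D f + p' *: D g] into one multiple
    [(p + p') *: D h]. *)
Lemma face_leD t e y z (r q : R) : `|e| = 1 -> face_le t e y r ->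
  face_le t e z q -> face_le t e (y + z) (r + q).
Proof.
move=> e1 yr zq eps e0; have e20 : 0 < eps / 2 by rewrite divr_gt0.
have [f [p [Ff p0 yp]]] := yr _ e20; have [g [p' [Fg p'0 zp]]] := zq _ e20.
have [pp0|pp0] := eqVneq (p + p') 0.
  have [pe pe'] : p = 0 /\ p' = 0 by split; lra.
  exists f, 0; split => //; rewrite scale0r addr0 (le_trans (ler_normD _ _))//.
  by move: yp zp; rewrite pe pe' !scale0r !addr0; lra.
have ppgt0 : 0 < p + p' by rewrite lt_neqAle eq_sym pp0 addr_ge0.
have r01 : 0 <= p' / (p + p') <= 1.
  by rewrite divr_ge0 ?(ltW ppgt0)//= ler_pdivrMr// mul1r lerDr.
have [h Fh Dh] := face_image_convex hausK D_sphere D_surj D_isom e1 Ff Fg r01.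
exists h, (p + p'); split => //; first exact: ltW.
have -> : y + z + (p + p') *: D h = (y + p *: D f) + (z + p' *: D g).
  by rewrite Dh; lmod R.
by rewrite (le_trans (ler_normD _ _))//; lra.
Qed.

Lemma face_le0 t e : `|e| = 1 -> face_le t e 0 0.
Proof.
move=> e1 eps e0; have [g Fg _] := face_cst cptK t e1; exists g, 0.
by split => //; rewrite scale0r addr0 normr0 !add0r ltW.
Qed.

Lemma face_leZ t e y (r a : R) : `|e| = 1 -> 0 <= a -> face_le t e y r ->
  face_le t e (a *: y) (a * r).
Proof.
move=> e1 a0 yr; have [->|an0] := eqVneq a 0.
  by rewrite scale0r mul0r; exact: face_le0.
have agt0 : 0 < a by rewrite lt_neqAle eq_sym an0.
move=> eps e0; have [g [p [Fg p0 yp]]] := yr _ (divr_gt0 e0 agt0).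
exists g, (a * p); split; rewrite ?mulr_ge0//.
rewrite -scalerA -scalerDr normrZ ger0_norm//.
rewrite (le_trans (ler_wpM2l a0 yp))// !mulrDr [a * (_ / _)]mulrC divfK//.
Qed.

Lemma face_le_mono t e y (r q : R) : r <= q -> face_le t e y r -> face_le t e y q.
Proof.
move=> rq yr eps e0; have [g [p [Fg p0 yp]]] := yr _ e0; exists g, p.
by split => //; rewrite (le_trans yp)// !lerD.
Qed.

Lemma face_le_dist t e y z (r : R) : face_le t e y r ->
  face_le t e z (r + `|z - y|).
Proof.
move=> yr eps e0; have [g [p [Fg p0 yp]]] := yr _ e0; exists g, p; split => //.
have -> : z + p *: D g = (y + p *: D g) + (z - y) by lmod R.
by rewrite (le_trans (ler_normD _ _))//; lra.
Qed.

Lemma face_convex t e f g (r : R) : `|e| = 1 -> 0 <= r <= 1 ->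
  face t e f -> face t e g -> face t e ((1 - r) *: f + r *: g).
Proof.
move=> e1 r01 [f1 fe] [g1 ge]; apply: face_norm1 => //.
  by rewrite norm_mix_le ?f1 ?g1.
by rewrite !contfunE fe ge; lmod R.
Qed.

Lemma face_le_lim t e y (r : R) :
  (forall eps, 0 < eps -> face_le t e y (r + eps)) -> face_le t e y r.
Proof.
move=> yr eps e0; have e20 : 0 < eps / 2 by rewrite divr_gt0.
have [g [p [Fg p0 yp]]] := yr _ e20 _ e20.
by exists g, p; split => //; rewrite (le_trans yp)//; lra.
Qed.

(** The norm is additive on the cone over the image of a face, so the functional is at least [a] at
    [a *: D f]. *)
Lemma face_le_face t e f (a r : R) : `|e| = 1 -> face t e f -> 0 <= a ->
  face_le t e (a *: D f) r -> a <= r.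
Proof.
move=> e1 Ff a0 ar; apply/ler_addgt0Pr => eps e0.
have [g [p [Fg p0]]] := ar _ e0.
have := face_image_sum3 D_sphere D_surj D_isom e1 Ff Fg Ff a0 p0 (lexx 0).
by rewrite scale0r !addr0 => ->; lra.
Qed.

(** Take [p = 1] and [D h = - D g], with [g] an almost nearest point to [f] in the opposite face. *)
Lemma face_le_antipode t e f : `|e| = 1 -> `|f| = 1 ->
  face_le t e (D f) (`|f t + e| - 1).
Proof.
move=> e1 f1 eps e0; have ne1 : `|- e| = 1 by rewrite normrN.
have [|g Fg fg] := face_dist hausK t _ ne1 e0 (f := f); first by rewrite f1.
have [h + Dh] := antipode_face hausK D_sphere D_surj D_isom ne1 Fg.
rewrite opprK => Fh; exists h, 1; split => //; rewrite Dh scale1r.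
by rewrite D_isom//; [move: fg; rewrite opprK; lra|case: Fg].
Qed.

(** [z0] vanishes at [t] but shares with [f] a face at [s], on which [D] is affine. The antipodal
    bound gives 0 at [- D z0], and near [z0] it is linear to first order. *)
Lemma face_le_away t e f s : `|e| = 1 -> `|f| = 1 -> s <> t -> `|f s| = 1 ->
  face_le t e (D f) '[f t, e].
Proof.
move=> e1 f1 st fs1.
have Us : nbhs t (~` [set s]).
  apply: open_nbhs_nbhs; split; last by move=> /= ts; apply: st.
  apply: closed_openC; apply: accessible_closed_set1.
  exact: hausdorff_accessible.
have [w [cw w01 wt w0]] := bump R cptK hausK Us.
have [z0 z0E] := contfun_mix f 0 cw.
have z0x x : z0 x = (1 - w x) *: f x by rewrite z0E scaler0 addr0.
have ws : w s = 0 by apply: w0 => /=; apply.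
have z0t : z0 t = 0 by rewrite z0x wt subrr scale0r.
have z0s : z0 s = f s by rewrite z0x ws subr0 scale1r.
have Fz : face s (f s) z0.
  apply: face_norm1 => //; apply: contfun_norm_le => // x.
  rewrite z0E norm_mix_le ?normr0//.
  by rewrite -f1 contfun_norm_ge.
have z1 : `|z0| = 1 by case: Fz.
have nz : face_le t e (- D z0) 0.
  rewrite -(sphere_isometry_opp hausK D_sphere D_surj D_isom z1).
  have := @face_le_antipode t e (- z0) e1; rewrite normrN => /(_ z1).
  by rewrite contfunN z0t oppr0 add0r e1 subrr.
(* Recovering [D f] from [D g] divides by [r], which turns the error [r^2 / 2] into [r / 2]. *)
have le (r : R) : 0 < r -> r <= 1 -> face_le t e (D f) ('[f t, e] + r / 2).
  move=> r0 r1; have r01 : 0 <= r <= 1 by rewrite ltW.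
  pose g : C := (1 - r) *: z0 + r *: f; have rn := lt0r_neq0 r0.
  have Dg : D g = (1 - r) *: D z0 + r *: D f.
    exact: (face_affine hausK D_sphere D_surj D_isom fs1 Fz).
  have [g1 _] : face s (f s) g by exact: face_convex.
  have -> : D f = r^-1 *: D g + ((1 - r) / r) *: - D z0 by rewrite Dg; lmod R.
  have gt : `|g t + e| <= 1 + r * '[f t, e] + r ^+ 2 / 2.
    rewrite !contfunE z0t scaler0 add0r addrC norm_unit_addZ_le//.
    by rewrite -f1 contfun_norm_ge.
  apply: face_le_mono (face_leD e1 (face_leZ e1 _ (face_le_antipode t e1 g1))
    (face_leZ e1 _ nz)); rewrite ?invr_ge0 ?divr_ge0 ?subr_ge0 ?(ltW r0)//.
  rewrite mulr0 addr0 ler_pdivrMl//; move: gt; rewrite expr2; lra.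
apply: face_le_lim => eps e0; pose r := Num.min 1 eps.
have r0 : 0 < r by rewrite lt_min ltr01.
have r1 : r <= 1 by rewrite ge_min lexx.
have re : r <= eps by rewrite ge_min lexx orbT.
by apply: face_le_mono (le _ r0 r1); rewrite lerD2l; lra.
Qed.

(* A function peaking only at [t] is, up to [eps], a convex combination of two
   functions with the same value at [t] and of norm one at [s]. *)
Lemma face_le_nontrivial t e f s : `|e| = 1 -> `|f| = 1 -> s <> t ->
  face_le t e (D f) '[f t, e].
Proof.
move=> e1 f1 st.
have [[s' [s't fs'1]]|nos'] := pselect (exists s', s' <> t /\ `|f s'| = 1).
  exact: face_le_away fs'1.
have ft1 : `|f t| = 1.
  have [t0 ft0] := unit_value f1; have [<-//|tt0] := pselect (t0 = t).
  by exfalso; apply: nos'; exists t0.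
apply: face_le_lim => eps e0.
have [c c1 fsc] : exists2 c, `|c| = 1 & f s = `|f s| *: c.
  have [->|fs0] := eqVneq (f s) 0.
    by exists (f t); rewrite // normr0 scale0r.
  exists (`|f s|^-1 *: f s); first by rewrite normrZ normfV normr_id mulVf ?normr_eq0.
  by rewrite scalerA divff ?normr_eq0// scale1r.
have nc1 : `|- c| = 1 by rewrite normrN.
have Us : nbhs s ([set x | `|f x - f s| <= eps] `&` ~` [set t]).
  apply: filterI; first exact: near_close.
  apply: open_nbhs_nbhs; split; last by [].
  apply: closed_openC; apply: accessible_closed_set1.
  exact: hausdorff_accessible.
have [w [cw w01 ws w0]] := bump R cptK hausK Us.
have wt : w t = 0 by apply: w0 => -[_]; apply.
(* The bump avoids [t], so the value there is kept, while norm one is reached at [s], as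
   [face_le_away] requires. *)
have push c' : `|c'| = 1 -> exists g : C,
    [/\ face t (f t) g, g s = c' & forall x, g x = (1 - w x) *: f x + w x *: c'].
  move=> c'1; have [k kc'] := contfun_cst cptK c'.
  have [g gE] := contfun_mix f k cw; exists g.
  split; [|by rewrite gE ws subrr scale0r kc' scale1r add0r|by move=> x; rewrite gE kc'].
  apply: face_norm1 => //; last by rewrite gE wt subr0 scale1r scale0r addr0.
  apply: contfun_norm_le => // x; rewrite gE kc' norm_mix_le ?c'1//.
  by rewrite -f1 contfun_norm_ge.
have [g [Fg gs gE]] := push _ nc1; have [h [Fh hs hE]] := push _ c1.
(* With this weight [(1 - r) (- c) + r c = |f s| c = f s]. *)
pose r := (1 + `|f s|) / 2; have fs1 : `|f s| <= 1 by rewrite -f1 contfun_norm_ge.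
have fs0 := normr_ge0 (f s).
have r01 : 0 <= r <= 1 by rewrite /r; apply/andP; split; lra.
have [k1 kt] := face_convex ft1 r01 Fg Fh; set k : C := _ + _ in k1 kt.
have kx x : k x = (1 - w x) *: f x + w x *: f s.
  by rewrite !contfunE gE hE {1}fsc /r; lmod R.
have [[g1 gt] [h1 ht]] := (Fg, Fh).
have kle : face_le t e (D k) '[f t, e].
  rewrite (face_affine hausK D_sphere D_surj D_isom ft1 Fg Fh r01).
  have -> : '[f t, e] = (1 - r) * '[g t, e] + r * '[h t, e] by rewrite gt ht; ring.
  case/andP: r01 => r0 r1.
  apply: face_leD => //; apply: face_leZ; rewrite ?subr_ge0//.
    by apply: (@face_le_away _ _ _ s); rewrite ?gs.
  by apply: (@face_le_away _ _ _ s); rewrite ?hs.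
apply: face_le_mono (face_le_dist (D f) kle); rewrite lerD2l D_isom//.
apply: contfun_norm_le => [|x]; first exact: ltW.
rewrite contfunD contfunN kx.
have -> : f x - ((1 - w x) *: f x + w x *: f s) = w x *: (f x - f s) by lmod R.
have /andP[wx0 wx1] := w01 x.
have [[xU _]|/w0 ->] := pselect (([set x | `|f x - f s| <= eps] `&` ~` [set t]) x).
  by rewrite normrZ ger0_norm// (le_trans (ler_piMl _ wx1)).
by rewrite scale0r normr0 ltW.
Qed.

(** * The case of a one-point space *)

Lemma sphere_isometry_normD f g : `|f| = 1 -> `|g| = 1 ->
  `|D f + D g| = `|f + g|.
Proof.
move=> f1 g1; rewrite -[D g]opprK.
rewrite -(sphere_isometry_opp hausK D_sphere D_surj D_isom g1).
by rewrite D_isom ?normrN// opprK.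
Qed.

(** The norm of [C] is now that of [H] at [t], so [Y] inherits the parallelogram identity on unit
    vectors. In the Euclidean plane of [D ce] and [D cu], the quantity [sqrt ((a + p)^2 + b^2) - p]
    tends to [a] as [p] grows. *)
Lemma face_le_trivial t e f : `|e| = 1 -> `|f| = 1 -> (forall s, s = t) ->
  face_le t e (D f) '[f t, e].
Proof.
move=> e1 f1 st.
have nE g : `|g| = `|g t|.
  apply/eqP; rewrite eq_le contfun_norm_ge andbT contfun_norm_le// => x.
  by rewrite (st x).
have ft1 : `|f t| = 1 by rewrite -nE.
pose a := '[f t, e]; pose q := f t - a *: e.
have ee : '[e, e] = 1 by rewrite inner_norm e1 expr1n.
have qe : '[q, e] = 0 by rewrite /q innerDl innerNl innerZl ee mulr1 subrr.
(* If [q = 0], then [f t] is [e] or [- e], and the antipodal bound already equals [a]. *)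
have [q0|q0] := eqVneq q 0.
  have fta : f t = a *: e by apply/eqP; rewrite -subr_eq0 -/q q0.
  have a1 : `|a| = 1 by move: ft1; rewrite fta normrZ e1 mulr1.
  have an1 : -1 <= a by have := ler_norm (- a); rewrite normrN a1; lra.
  apply: face_le_mono (face_le_antipode t e1 f1).
  have -> : f t + e = (a + 1) *: e by rewrite fta; lmod R.
  by rewrite normrZ e1 mulr1 ger0_norm -/a; lra.
pose b := `|q|; pose u := b^-1 *: q.
have b0 : b != 0 by rewrite normr_eq0.
have u1 : `|u| = 1 by rewrite normrZ normfV normr_id mulVf.
have ue : '[u, e] = 0 by rewrite innerZl qe mulr0.
have eu : '[e, u] = 0 by rewrite innerC.
have ftE : f t = a *: e + b *: u by rewrite /u /q; lmod R.
have ab1 : a ^+ 2 + b ^+ 2 = 1.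
  have := normD_sqr (a *: e) (b *: u); rewrite -ftE ft1 innerZl innerZr eu.
  by rewrite (normrZ a) (normrZ b) e1 u1 !mulr1 !real_normK ?num_real// !mulr0 addr0 expr1n.
have par (p p' : Y) : `|p| = 1 -> `|p'| = 1 -> `|p + p'| ^+ 2 + `|p - p'| ^+ 2 = 4.
  move=> p1 p'1; have [g g1 <-] := D_surj p1; have [h h1 <-] := D_surj p'1.
  rewrite sphere_isometry_normD// D_isom// !nE !contfunE normD_sqr normB_sqr.
  by rewrite -!nE g1 h1; ring.
have [ce [ce1 _] ceE] := face_cst cptK t e1.
have [cu [cu1 _] cuE] := face_cst cptK t u1.
have P1 := D_sphere ce1; have Q1 := D_sphere cu1.
have PQ : `|D ce + D cu| ^+ 2 = 2.
  rewrite sphere_isometry_normD// nE contfunE ceE cuE normD_sqr e1 u1 eu.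
  by ring.
have nPQ := unit_parallelogram_normE par P1 Q1 PQ.
(* Distances from the preimage [k] to [ce] and [cu] fix the coordinates of [k t] along [e] and [u];
   being a unit vector, it has no further component. *)
have Df : D f = a *: D ce + b *: D cu.
  have [k k1 Dk] : exists2 k : C, `|k| = 1 & D k = a *: D ce + b *: D cu.
    by apply: D_surj; exact: (unit_parallelogram_norm par P1 Q1 PQ ab1).
  rewrite -Dk; congr D; apply: contfun_ext => x; rewrite (st x).
  have kt1 : `|k t| = 1 by rewrite -nE.
  have ke : '[k t, e] = a.
    have : `|D k - D ce| ^+ 2 = (a - 1) ^+ 2 + b ^+ 2.
      by rewrite -nPQ Dk; congr (`|_| ^+ 2); lmod R.
    rewrite D_isom// nE !contfunE ceE normB_sqr kt1 e1; move: ab1; lra.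
  have ku : '[k t, u] = b.
    have : `|D k - D cu| ^+ 2 = a ^+ 2 + (b - 1) ^+ 2.
      by rewrite -nPQ Dk; congr (`|_| ^+ 2); lmod R.
    rewrite D_isom// nE !contfunE cuE normB_sqr kt1 u1; move: ab1; lra.
  apply/eqP; rewrite -subr_eq0 -normr_eq0 -sqrf_eq0 normB_sqr ft1 kt1.
  rewrite ftE innerDl (innerZl a) (innerZl b) !(innerC _ (k t)) ke ku -!expr2.
  by apply/eqP; move: ab1; lra.
(* With this [p], [p + a] is at least [1 / eps], so the cross term [2 eps (p + a)] exceeds
   [b^2 <= 1]. *)
move=> eps e0; exists ce, (eps^-1 + 1).
have ei0 : 0 < eps^-1 by rewrite invr_gt0.
split; [by split|by rewrite addr_ge0 ?ltW|].
have -> : D f + (eps^-1 + 1) *: D ce = (a + (eps^-1 + 1)) *: D ce + b *: D cu.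
  by rewrite Df; lmod R.
have a1 : -1 <= a by nra.
have ee1 : eps^-1 * eps = 1 by rewrite mulVf// gt_eqF.
rewrite -ler_sqr ?nnegrE//; last by rewrite -/a; lra.
by rewrite nPQ -/a; nra.
Qed.

Lemma face_le_inner t e f : `|e| = 1 -> `|f| = 1 ->
  face_le t e (D f) '[f t, e].
Proof.
move=> e1 f1; have [[s st]|nos] := pselect (exists s, s <> t).
  exact: face_le_nontrivial st.
apply: face_le_trivial => // s; apply: contrapT => st.
by apply: nos; exists s.
Qed.

(** At 0 the factor [|f|] vanishes, so the arbitrary value [D 0] does not matter. *)
Definition homogeneous_extension f := `|f| *: D (`|f|^-1 *: f).
Local Notation T := homogeneous_extension.

Lemma normalize_norm1 (V : normedModType R) (v : V) : v != 0 ->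
  `| `|v|^-1 *: v| = 1.
Proof. by move=> v0; rewrite normrZ normfV normr_id mulVf// normr_eq0. Qed.

Lemma homogeneous_extension_sphere f : `|f| = 1 -> T f = D f.
Proof. by move=> f1; rewrite /T f1 invr1 !scale1r. Qed.

Lemma norm_homogeneous_extension f : `|T f| = `|f|.
Proof.
have [->|f0] := eqVneq f 0; first by rewrite /T normr0 scale0r normr0.
by rewrite normrZ normr_id D_sphere ?normalize_norm1// mulr1.
Qed.

Lemma homogeneous_extensionN f : T (- f) = - T f.
Proof.
have [->|f0] := eqVneq f 0; first by rewrite oppr0 /T normr0 scale0r oppr0.
rewrite /T normrN scalerN.
rewrite (sphere_isometry_opp hausK D_sphere D_surj D_isom) ?normalize_norm1//.
by rewrite scalerN.
Qed.

Lemma homogeneous_extensionZ (a : R) f : T (a *: f) = a *: T f.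
Proof.
wlog a0 : a / 0 <= a.
  move=> P; have [|/ltW a0] := leP 0 a; first exact: P.
  have -> : a *: f = - ((- a) *: f) by rewrite scaleNr opprK.
  by rewrite homogeneous_extensionN P ?oppr_ge0// scaleNr opprK.
have [->|an0] := eqVneq a 0; first by rewrite !scale0r /T normr0 scale0r.
have [->|f0] := eqVneq f 0; first by rewrite scaler0 /T normr0 !scale0r scaler0.
rewrite /T normrZ ger0_norm// -scalerA; congr (_ *: (_ *: D _)).
rewrite scalerA; congr (_ *: _).
by rewrite invfM mulrAC mulVf// mul1r.
Qed.

Lemma face_le_extension t e f : `|e| = 1 -> face_le t e (T f) '[f t, e].
Proof.
move=> e1; have [->|f0] := eqVneq f 0.
  rewrite /T normr0 scale0r -(scale0r (0 : C)) contfunZ innerZl mul0r.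
  exact: face_le0.
have -> : '[f t, e] = `|f| * '[(`|f|^-1 *: f : C) t, e].
  by rewrite contfunZ innerZl mulrA divff ?mul1r// normr_eq0.
by apply: face_leZ => //; apply: face_le_inner => //; exact: normalize_norm1.
Qed.

(* The functionals [face_le t e] detect every nonzero vector of [Y], because each
   point of its sphere lies in some [D @` face t e]. *)
Lemma homogeneous_extensionD f g : T (f + g) = T f + T g.
Proof.
apply/eqP; rewrite eq_sym -subr_eq0 -homogeneous_extensionN.
set z := _ + _; apply: contraT => z0.
have [h h1 Dh] := D_surj (normalize_norm1 z0).
have [t ht1] := unit_value h1.
suff : `|z| <= 0 by rewrite normr_le0 (negPf z0).
(* [z] is [|z| D h], where the functional is at least [|z|]; the three inner-product bounds add up
   to 0. *)
apply: (@face_le_face t (h t) h) => //.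
rewrite Dh scalerA divff ?normr_eq0// scale1r.
have -> : 0 = '[f t, h t] + '[g t, h t] + '[(- (f + g) : C) t, h t].
  by rewrite !contfunE innerNl innerDl subrr.
by apply: face_leD => //; [apply: face_leD => //|]; exact: face_le_extension.
Qed.

End extension.

(** The homogeneous extension is linear and preserves norms, hence distances; scaling preimages of
    normalized vectors gives surjectivity. *)
Theorem mazur_ulam_contfun (R : realType) (K : topologicalType)
    (cptK : compact [set: K]) (hausK : hausdorff_space K) (H : hilbertType R) :
  mazur_ulam (contfun cptK H).
Proof.
move=> Y D Dfun Dsurj Disom.
have D_sphere f : `|f| = 1 -> `|D f| = 1 by exact: Dfun.
have D_surj y : `|y| = 1 -> exists2 f : contfun cptK H, `|f| = 1 & D f = y.
  by move=> /Dsurj[f f1 fy]; exists f.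
have D_isom f g : `|f| = 1 -> `|g| = 1 -> `|D f - D g| = `|f - g|.
  by move=> f1 g1; apply: Disom; rewrite inE.
pose T := homogeneous_extension D.
have TL : linear T.
  move=> a f g; rewrite /T homogeneous_extensionD//.
  by rewrite homogeneous_extensionZ.
pose TT : {linear contfun cptK H -> Y} :=
  HB.pack T (GRing.isLinear.Build _ _ _ _ T TL).
exists TT; split.
- move=> f g _ _; rewrite -linearB.
  exact: norm_homogeneous_extension.
- move=> y _; have [->|y0] := eqVneq y 0; first by exists 0 => //; rewrite linear0.
  have [f f1 Df] := D_surj _ (normalize_norm1 y0).
  exists (`|y| *: f) => //; rewrite linearZ/= /T homogeneous_extension_sphere//.
  by rewrite Df scalerA divff ?normr_eq0// scale1r.
- by move=> f; rewrite inE => f1; exact: homogeneous_extension_sphere.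
Qed.

Theorem corollary5p8 (R : realType) (K : topologicalType)
  (cptK : compact [set: K]) (hausK : hausdorff_space K)
  (H : finDimHilbertType R) (oddH : odd (\dim {:H})) :
  mazur_ulam (contfun cptK H).
Proof. exact: mazur_ulam_contfun. Qed.
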